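(* For all $n\ge2$, all $P,Q\in\Gamma_n$ and all $t\in(-\infty,\infty)$, $$I(P\Vert Q)\le\tfrac18\mathcal V_t(P\Vert Q).$$
   Context: $\Gamma_n=\{P=(p_1,\dots,p_n): p_i>0,\ \sum_{i=1}^n p_i=1\}$. For $P,Q\in\Gamma_n$, the Jensen–Shannon divergence is $I(P\Vert Q)=\frac12\left[\sum_{i=1}^n p_i\ln\left(\frac{2p_i}{p_i+q_i}\right)+\sum_{i=1}^n q_i\ln\left(\frac{2q_i}{p_i+q_i}\right)\right]$, and $$\mathcal V_t(P\Vert Q)=\begin{cases}[t(t-1)]^{-1}\left[\sum_{i=1}^n\left(p_i^tq_i^{1-t}+p_i^{1-t}q_i^t\right)-2\right], & t\ne0,1,\\ \sum_{i=1}^n(p_i-q_i)\ln\left(\frac{p_i}{q_i}\right), & t=0,1.\end{cases}$$ *)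

(* Defs.v *)
From mathcomp Require Import all_boot all_order all_algebra.
From mathcomp Require Import boolp classical_sets reals exp.

Set Implicit Arguments.
Unset Strict Implicit.
Unset Printing Implicit Defensive.

Import Order.TTheory GRing.Theory Num.Theory.
Local Open Scope classical_set_scope.
Local Open Scope ring_scope.

Definition Gamma (R : realType) (n : nat) : set ('I_n -> R) :=
  [set P | (forall i, 0 < P i) /\ \sum_(i < n) P i = 1].

Definition JSdiv (R : realType) (n : nat) (P Q : 'I_n -> R) : R :=
  2^-1 * (\sum_(i < n) P i * ln (2 * P i / (P i + Q i))
          + \sum_(i < n) Q i * ln (2 * Q i / (P i + Q i))).

Definition Vdiv (R : realType) (n : nat) (t : R) (P Q : 'I_n -> R) : R :=
  if (t == 0) || (t == 1) then \sum_(i < n) (P i - Q i) * ln (P i / Q i)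
  else (t * (t - 1))^-1 *
       (\sum_(i < n) (P i `^ t * Q i `^ (1 - t) + P i `^ (1 - t) * Q i `^ t)
        - 2).

(* Main.v *)
Require Import Defs.
From mathcomp Require Import all_boot all_order all_algebra.
From mathcomp Require Import boolp classical_sets reals exp.
From mathcomp Require Import functions topology normedtype derive realfun.
From mathcomp Require Import ring lra.

Set Implicit Arguments.
Unset Strict Implicit.
Unset Printing Implicit Defensive.

Import Order.TTheory GRing.Theory Num.Theory.
Local Open Scope classical_set_scope.
Local Open Scope ring_scope.

Import numFieldNormedType.Exports.

(** Both divergences are Csiszar divergences: each equals
    [\sum_i Q i * f (P i / Q i)] for a generator [f] on the positive reals with
    [f 1 = f' 1 = 0].  It therefore suffices to compare the generators, and by
    Taylor's formula at [1] it is enough to compare their second derivatives.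
    These are [u^-1 (u + 1)^-1 / 2] for the Jensen-Shannon divergence and
    [u ^ (t - 2) + u ^ (- 1 - t)] for the other one.  The latter formula holds
    for every [t]: the logarithmic generator at [t = 0, 1] is the limit of the
    power generators, and two derivatives erase the difference between the two
    expressions ([is_derive_Vgen], [is_derive_Vgen1]).  After clearing
    denominators the inequality between second derivatives is
    [4 u <= (u ^ t + u ^ (1 - t)) (u + 1)], the product of the two
    arithmetic-geometric mean inequalities [2 sqrt u <= u ^ t + u ^ (1 - t)]
    and [2 sqrt u <= u + 1] ([jsgen2_le_Vgen2]). *)

(** * Taylor's formula at one *)

(** The intermediate point lies between [1] and [x], which is recorded in the
    form used for signs: [c - 1] and [x - 1] do not have opposite signs. *)
Lemma mean_value_from1 (R : realType) (f df : R -> R) (x : R) :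
    (forall u : R, 0 < u -> is_derive u 1 f (df u)) -> 0 < x ->
  exists c : R, [/\ 0 < c, 0 <= (c - 1) * (x - 1) & f x - f 1 = df c * (x - 1)].
Proof.
move=> dfE x0.
have cont (a b : R) : 0 < a -> {within `[a, b], continuous f}.
  move=> a0; apply: derivable_within_continuous => u.
  rewrite in_itv/= => /andP[au _].
  by apply: ex_derive; apply: dfE; exact: lt_le_trans au.
have seg (a b : R) : 0 < a -> a <= b ->
    exists2 c, c \in `[a, b] & f b - f a = df c * (b - a).
  move=> a0 ab; apply: MVT_segment => // [u|]; last exact: cont.
  rewrite in_itv/= => /andP[au _]; apply: dfE; exact: lt_trans au.
have [x1|/ltW x1] := leP x 1.
  have [c] := seg _ _ x0 x1; rewrite in_itv/= => /andP[xc c1] E.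
  exists c; split; [exact: lt_le_trans xc| |by lra].
  by rewrite mulr_le0 // subr_le0.
have [c] := seg _ _ ltr01 x1; rewrite in_itv/= => /andP[xc c1] E.
exists c; split => //; first exact: lt_le_trans xc.
by rewrite mulr_ge0 // subr_ge0.
Qed.

(** Applying the mean value theorem to [f] and then to [f1] gives
    [f x = f2 d * ((c - 1) * (x - 1))], where both factors are nonnegative. *)
Lemma convex_ge0_from1 (R : realType) (f f1 f2 : R -> R) (x : R) :
    (forall u : R, 0 < u -> is_derive u 1 f (f1 u)) ->
    (forall u : R, 0 < u -> is_derive u 1 f1 (f2 u)) ->
    (forall u : R, 0 < u -> 0 <= f2 u) ->
    f 1 = 0 -> f1 1 = 0 -> 0 < x ->
  0 <= f x.
Proof.
move=> df df1 f2_ge0 f10 f110 x0.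
have [c [c0 cx]] := mean_value_from1 df x0.
rewrite f10 subr0 => ->.
have [d [d0 _]] := mean_value_from1 df1 c0.
by rewrite f110 subr0 => ->; rewrite -mulrA mulr_ge0 // f2_ge0.
Qed.

(** * The generators and their derivatives *)

(** The two logarithms [ln (2 u / (u + 1))] and [ln (2 / (u + 1))] of the usual
    form are regrouped so that each remaining logarithm has a simple
    derivative. *)
Definition jsgen (R : realType) (u : R) : R :=
  2^-1 * (u * ln u - (u + 1) * ln ((u + 1) / 2)).

Definition jsgen1 (R : realType) (u : R) : R :=
  2^-1 * (ln u - ln ((u + 1) / 2)).

Definition jsgen2 (R : realType) (u : R) : R := 2^-1 * (u^-1 - (u + 1)^-1).

Definition Vgen (R : realType) (t u : R) : R :=
  if (t == 0) || (t == 1) then (u - 1) * ln u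
  else (t * (t - 1))^-1 * (u `^ t + u `^ (1 - t) - (u + 1)).

Definition Vgen1 (R : realType) (t u : R) : R :=
  if (t == 0) || (t == 1) then ln u + 1 - u^-1
  else (t * (t - 1))^-1 * (t * u `^ (t - 1) + (1 - t) * u `^ (- t) - 1).

Definition Vgen2 (R : realType) (t u : R) : R := u `^ (t - 2) + u `^ (- 1 - t).

Lemma jsgen_at1 (R : realType) : jsgen (1 : R) = 0.
Proof.
by rewrite /jsgen (_ : (1 + 1) / 2 = 1 :> R) ?ln1 ?mulr0 ?subrr ?mulr0 //; field.
Qed.

Lemma jsgen1_at1 (R : realType) : jsgen1 (1 : R) = 0.
Proof.
by rewrite /jsgen1 (_ : (1 + 1) / 2 = 1 :> R) ?subrr ?mulr0 //; field.
Qed.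

Lemma Vgen_at1 (R : realType) (t : R) : Vgen t 1 = 0.
Proof. by rewrite /Vgen !powR1 ln1 mulr0 subrr mulr0; case: ifP. Qed.

Lemma Vgen1_at1 (R : realType) (t : R) : Vgen1 t 1 = 0.
Proof.
rewrite /Vgen1 !powR1 ln1 invr1; case: ifP => _; first by ring.
by rewrite (_ : _ + _ - 1 = 0) ?mulr0 //; ring.
Qed.

Lemma is_derive_ln_mid (R : realType) (u : R) : 0 < u ->
  is_derive u 1 (fun v : R => ln ((v + 1) / 2)) (u + 1)^-1.
Proof.
move=> u0; have h0 : 0 < (u + 1) / 2 by lra.
have dh : is_derive u (1 : R) (fun v : R => (v + 1) / 2) 2^-1.
  apply: (is_derive_eq (is_deriveM
    (is_deriveD (is_derive_id u 1) (is_derive_cst (1 : R) u 1))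
    (is_derive_cst (2^-1 : R) u 1))).
  by rewrite scaler0 add0r addr0 /cst /GRing.scale/= mulr1.
apply: (is_derive_eq (is_derive1_comp (g := fun v : R => (v + 1) / 2)
                        (is_derive1_ln h0) dh)).
by field; lra.
Qed.

Lemma is_derive_jsgen (R : realType) (u : R) : 0 < u ->
  is_derive u 1 (@jsgen R) (jsgen1 u).
Proof.
move=> u0.
have d1 := is_deriveM (is_derive_id u 1) (is_derive1_ln u0).
have d2 := is_deriveM (is_deriveD (is_derive_id u 1) (is_derive_cst (1 : R) u 1))
  (is_derive_ln_mid u0).
apply: (is_derive_eq (is_deriveZ 2^-1 (is_deriveB d1 d2))).
by rewrite /jsgen1 !fctE /GRing.scale/=; field; apply/andP; split; lra.
Qed.

Lemma is_derive_jsgen1 (R : realType) (u : R) : 0 < u ->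
  is_derive u 1 (@jsgen1 R) (jsgen2 u).
Proof.
move=> u0.
by have := is_deriveZ 2^-1 (is_deriveB (is_derive1_ln u0) (is_derive_ln_mid u0)).
Qed.

Lemma is_derive_Vgen (R : realType) (t u : R) : 0 < u ->
  is_derive u 1 (Vgen t) (Vgen1 t u).
Proof.
move=> u0; rewrite /Vgen /Vgen1; case: ifP => [_|/negbT].
  have d := is_deriveM (is_deriveB (is_derive_id u 1) (is_derive_cst (1 : R) u 1))
    (is_derive1_ln u0).
  by apply: (is_derive_eq d); rewrite !fctE /GRing.scale/=; field; lra.
rewrite negb_or => /andP[t0 t1].
have d := is_deriveZ (t * (t - 1))^-1
  (is_deriveB (is_deriveD (is_derive1_powR t u0) (is_derive1_powR (1 - t) u0))
     (is_deriveD (is_derive_id u 1) (is_derive_cst (1 : R) u 1))).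
apply: (is_derive_eq d).
by rewrite /GRing.scale/= addr0 (_ : 1 - t - 1 = - t) //; ring.
Qed.

Lemma is_derive_Vgen1 (R : realType) (t u : R) : 0 < u ->
  is_derive u 1 (Vgen1 t) (Vgen2 t u).
Proof.
move=> u0; rewrite /Vgen1 /Vgen2.
case: (boolP ((t == 0) || (t == 1))) => [t01|].
  have d := is_deriveB
    (is_deriveD (is_derive1_ln u0) (is_derive_cst (1 : R) u 1))
    (is_deriveV (lt0r_neq0 u0) (is_derive_id u 1)).
  apply: (is_derive_eq d); rewrite /GRing.scale/=.
  have p1 x : x = - 1 -> u `^ x = u^-1 by move=> ->; rewrite powR_inv1 ?ltW.
  have p2 x : x = - 2 -> u `^ x = u ^- 2 by move=> ->; rewrite powR_invn ?ltW.
  case/orP: t01 => /eqP ->.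
    by rewrite p2 ?p1; [field; lra|ring..].
  by rewrite p1 ?p2; [field; lra|ring..].
rewrite negb_or => /andP[t0 t1].
have d := is_deriveZ (t * (t - 1))^-1
  (is_deriveB (is_deriveD (is_deriveZ t (is_derive1_powR (t - 1) u0))
                 (is_deriveZ (1 - t) (is_derive1_powR (- t) u0)))
     (is_derive_cst (1 : R) u 1)).
apply: (is_derive_eq d); rewrite /GRing.scale/=.
have -> : t - 1 - 1 = t - 2 by ring.
have -> : - t - 1 = - 1 - t by ring.
by field; rewrite subr_eq0 t0 t1.
Qed.

(** Multiplying by [8 u^2 (u + 1)] turns this into
    [4 u <= (u ^ t + u ^ (1 - t)) (u + 1)].  Both factors on the right are at
    least [2 sqrt u] by the arithmetic-geometric mean inequality, because
    [u ^ t * u ^ (1 - t) = u * 1 = u]. *)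
Lemma jsgen2_le_Vgen2 (R : realType) (t u : R) : 0 < u ->
  jsgen2 u <= 8^-1 * Vgen2 t u.
Proof.
move=> u0; have u00 := lt0r_neq0 u0; have u0' := ltW u0.
have powE (x : R) : u `^ x = u `^ (x / 2) ^+ 2.
  by rewrite -powR_mulrn ?powR_ge0 // -powRrM; congr (_ `^ _); field.
have pE (x : R) : u `^ (x - 2) = u `^ x * u ^- 2.
  by rewrite powRD ?powR_invn ?u00 ?implybT.
have sqE : u `^ (t / 2) * u `^ ((1 - t) / 2) = Num.sqrt u.
  by rewrite -powRD ?u00 ?implybT // -powR12_sqrt //; congr (_ `^ _); field.
have s2 : Num.sqrt u ^+ 2 = u by rewrite sqr_sqrtr.
have s0 : 0 <= Num.sqrt u := sqrtr_ge0 u.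
have amgm1 : 2 * Num.sqrt u <= u `^ t + u `^ (1 - t).
  rewrite (powE t) (powE (1 - t)) -sqE -subr_ge0.
  rewrite (_ : _ - _ = (u `^ (t / 2) - u `^ ((1 - t) / 2)) ^+ 2); last by ring.
  exact: sqr_ge0.
have amgm2 : 2 * Num.sqrt u <= u + 1.
  rewrite -subr_ge0 -{1}s2.
  rewrite (_ : _ - _ = (Num.sqrt u - 1) ^+ 2); last by ring.
  exact: sqr_ge0.
have key : 4 * u <= (u `^ t + u `^ (1 - t)) * (u + 1).
  rewrite -{1}s2 (_ : 4 * _ = 2 * Num.sqrt u * (2 * Num.sqrt u)); last by ring.
  by apply: ler_pM => //; apply: mulr_ge0.
rewrite /jsgen2 /Vgen2 (_ : - 1 - t = 1 - t - 2); last by ring.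
rewrite !pE -subr_ge0.
rewrite (_ : _ - _ = ((u `^ t + u `^ (1 - t)) * (u + 1) - 4 * u)
                     * (8 * u ^+ 2 * (u + 1))^-1); last first.
  by field; rewrite u00 lt0r_neq0 //; lra.
by rewrite mulr_ge0 ?subr_ge0 // invr_ge0 !mulr_ge0 ?exprn_ge0 //; lra.
Qed.

Lemma jsgen_le_Vgen (R : realType) (t u : R) : 0 < u ->
  jsgen u <= 8^-1 * Vgen t u.
Proof.
move=> u0; rewrite -subr_ge0.
apply: (@convex_ge0_from1 R (fun v => 8^-1 * Vgen t v - jsgen v)
  (fun v => 8^-1 * Vgen1 t v - jsgen1 v)
  (fun v => 8^-1 * Vgen2 t v - jsgen2 v)) => // [v v0|v v0|v v0||].
- exact: is_deriveB (is_deriveZ _ (is_derive_Vgen t v0)) (is_derive_jsgen v0).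
- exact: is_deriveB (is_deriveZ _ (is_derive_Vgen1 t v0)) (is_derive_jsgen1 v0).
- by rewrite subr_ge0 jsgen2_le_Vgen2.
- by rewrite Vgen_at1 jsgen_at1 mulr0 subrr.
- by rewrite Vgen1_at1 jsgen1_at1 mulr0 subrr.
Qed.

(** * The divergences as sums of generators *)

Lemma JSdivE (R : realType) (n : nat) (P Q : 'I_n -> R) :
    (forall i, 0 < P i) -> (forall i, 0 < Q i) ->
  JSdiv P Q = \sum_(i < n) Q i * jsgen (P i / Q i).
Proof.
move=> P0 Q0; rewrite /JSdiv -big_split/= mulr_sumr; apply: eq_bigr => i _.
move: (P i) (Q i) (P0 i) (Q0 i) => p q p0 q0; rewrite /jsgen.
have pq0 : 0 < p + q by rewrite addr_gt0.
rewrite (_ : (p / q + 1) / 2 = (p + q) / (2 * q)); last by field; lra.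
rewrite !ln_div ?lnM ?posrE ?mulr_gt0 //.
by field; lra.
Qed.

(** The term [u + 1] of the power generator contributes
    [\sum_i (P i + Q i)], which is the constant [2] because [P] and [Q] are
    probability vectors. *)
Lemma VdivE (R : realType) (n : nat) (t : R) (P Q : 'I_n -> R) :
    Gamma P -> Gamma Q ->
  Vdiv t P Q = \sum_(i < n) Q i * Vgen t (P i / Q i).
Proof.
move=> [P0 P1] [Q0 Q1]; rewrite /Vdiv /Vgen; case: ifP => _.
  apply: eq_bigr => i _; rewrite mulrA; congr (_ * _).
  by field; rewrite lt0r_neq0.
have -> : 2 = \sum_(i < n) (P i + Q i) by rewrite big_split/= P1 Q1.
rewrite -sumrB mulr_sumr; apply: eq_bigr => i _.
move: (P i) (Q i) (P0 i) (Q0 i) => p q p0 q0.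
have q00 := lt0r_neq0 q0.
have homog (x : R) : p `^ x * q `^ (1 - x) = q * (p / q) `^ x.
  rewrite powRM ?invr_ge0 ?ltW // powRD ?q00 ?implybT // powRr1 ?ltW //.
  by rewrite -[q^-1]powR_inv1 ?ltW // -powRrM mulN1r; ring.
have -> : q `^ t = q `^ (1 - (1 - t)) by congr (_ `^ _); ring.
rewrite !homog mulrCA; congr (_ * _).
by field.
Qed.

Theorem mainTheorem12 (R : realType) (n : nat) (hn : (2 <= n)%N)
    (P Q : 'I_n -> R) (hP : Gamma P) (hQ : Gamma Q) (t : R) :
  JSdiv P Q <= 8^-1 * Vdiv t P Q.
Proof.
have [P0 _] := hP; have [Q0 _] := hQ.
rewrite JSdivE // VdivE // mulr_sumr; apply: ler_sum => i _.
by rewrite [leRHS]mulrCA ler_pM2l // jsgen_le_Vgen // divr_gt0.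
Qed.
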